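(* Let $G$ be a countable discrete group, $X$ a countable discrete set, and $\alpha: G \curvearrowright X$ an action. The following are equivalent: (1) $\alpha$ is sofic; (2) there exist a free ultrafilter $\mathcal{U}$ on $\mathbb{N}$, a group homomorphism $\varphi: G \rightarrow \prod_\mathcal{U} (S_n, d)$, and a map $\pi: X \rightarrow \mathbb{X}_\mathcal{U}$ such that $\mathbb{S}_\mathcal{U}(\varphi(g))(\pi(x)) = \pi(\alpha(g)x)$ for all $x \in X$, $g \in G$, and such that $d_\mathcal{U}(\pi(x), \pi(y)) = 1$ for all $x \neq y$ in $X$.
   Context: For a nonempty finite set $A$, $\mathrm{Sym}(A)$ is the group of permutations of $A$, with the normalized Hamming distance $d(\sigma,\tau) = |\{a \in A : \sigma(a) \neq \tau(a)\}|/|A|$. $S_n = \mathrm{Sym}([n])$ with $[n]=\{1,\dots,n\}$. Let $\alpha: G \curvearrowright X$ be an action of a countable discrete group on a countable discrete set, $A$ a finite set, $\varphi: G \to \mathrm{Sym}(A)$ a map (not necessarily a homomorphism). $\varphi$ is unital if $\varphi(1_G) = 1$. For finite $F \subseteq G$ and $\epsilon > 0$, $\varphi$ is $(F,\epsilon)$-multiplicative if $d(\varphi(gh), \varphi(g)\varphi(h)) < \epsilon$ for all $g,h \in F$. For finite $F \subseteq G$, finite $E \subseteq X$ and $\epsilon > 0$, $\varphi$ is an $(F,E,\epsilon)$-orbit approximation of $\alpha$ if there exist a finite set $B$ and a subset $S \subseteq A$ with $|S| > (1-\epsilon)|A|$ and, for each $s \in S$, an injective map $\pi_s: E \hookrightarrow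 B$, such that $\pi_{\varphi(g)s}(x) = \pi_s(\alpha(g^{-1})x)$ for all $s \in S$, $g \in F$, $x \in E$ whenever $\varphi(g)s \in S$ and $\alpha(g^{-1})x \in E$. The action $\alpha$ is sofic if for all finite $F \subseteq G$, finite $E \subseteq X$ and $\epsilon > 0$ there exist a finite set $A$ and a map $\varphi: G \to \mathrm{Sym}(A)$ which is unital, $(F,\epsilon)$-multiplicative, and an $(F,E,\epsilon)$-orbit approximation of $\alpha$. For a sequence of metric spaces $(X_n,d_n)$ (with uniformly bounded metrics) and a free ultrafilter $\mathcal{U}$ on $\mathbb{N}$, the metric ultraproduct $\prod_\mathcal{U}(X_n,d_n)$ is the quotient of $\prod_n X_n$ by the relation $f \sim g$ iff $\lim_\mathcal{U} d_n(f(n),g(n)) = 0$; the class of $(x_n)$ is written $(x_n)_\mathcal{U}$, and the metric is $d_\mathcal{U}((x_n)_\mathcal{U},(y_n)_\mathcal{U}) = \lim_\mathcal{U} d_n(x_n,y_n)$. The group $\prod_\mathcal{U}(S_n,d)$ (with coordinatewise multiplication) is the universal sofic group. Let $X_n$ be the set of all maps $[n] \to \mathbb{N}$ with normalized Hamming distance $d_n(f,g) = \frac1n|\{k \in [n] : f(k) \neq g(k)\}|$, and let $\mathbb{X}_\mathcal{U} = \prod_\mathcal{U}(X_n,d_n)$. The universal sofic action $\mathbb{S}_\mathcal{U}: \prod_\mathcal{U}(S_n,d) \curvearrowright \mathbb{X}_\mathcal{U}$ is the (well-defined, isometric) action $\mathbb{S}_\mathcal{U}((g_n)_\mathcal{U})((f_n)_\mathcal{U})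 = (f_n \circ g_n^{-1})_\mathcal{U}$. *)

(* Defs.v *)
From HB Require Import structures.
From mathcomp Require Import all_boot all_order all_algebra all_fingroup.
From mathcomp Require Import generic_quotient lra.
From mathcomp Require Import all_classical all_reals all_analysis.

Set Implicit Arguments.
Unset Strict Implicit.
Unset Printing Implicit Defensive.

Import Order.TTheory GRing.Theory Num.Theory.
Import numFieldNormedType.Exports.

Local Open Scope classical_set_scope.
Local Open Scope quotient_scope.
Local Open Scope ring_scope.

Section Hamming.
Context {R : realType} {A : finType} {T : eqType}.
Implicit Types f g h : A -> T.

Definition hamming f g : R := #|[pred a | f a != g a]|%:R / #|A|%:R.

Lemma hamming_ge0 f g : 0 <= hamming f g.
Proof. by rewrite divr_ge0. Qed.

Lemma hamming_le1 f g : hamming f g <= 1.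
Proof.
rewrite /hamming; have [->|A0] := eqVneq #|A| 0%N; first by rewrite invr0 mulr0.
by rewrite ler_pdivrMr ?ltr0n ?lt0n// mul1r ler_nat max_card.
Qed.

Lemma hammingxx f : hamming f f = 0.
Proof.
rewrite /hamming eq_card0 ?mul0r// => a.
by rewrite !inE eqxx.
Qed.

Lemma hamming_eq0 f g : hamming f g = 0 -> f =1 g.
Proof.
move=> /eqP; rewrite mulf_eq0 invr_eq0 !pnatr_eq0 => fg a; apply/eqP.
have A0 : #|A| != 0%N by rewrite -lt0n; apply/card_gt0P; exists a.
move: fg; rewrite (negbTE A0) orbF => /eqP/card0_eq/(_ a).
by rewrite !inE => /negbFE.
Qed.

Lemma hammingC f g : hamming f g = hamming g f.
Proof.
by congr (_%:R / _); apply: eq_card => a; rewrite !inE eq_sym.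
Qed.

Lemma hamming_triangle g f h : hamming f h <= hamming f g + hamming g h.
Proof.
rewrite /hamming -mulrDl ler_wpM2r ?invr_ge0// -natrD ler_nat.
rewrite -cardUI; apply: leq_trans (leq_addr _ _).
apply/subset_leq_card/fintype.subsetP => a.
by rewrite !inE; case: (f a =P g a) => [->|].
Qed.

End Hamming.

(* Sym R A is the group of permutations of A under composition of functions,
   (s * t) a = s (t a), whereas the product of the library on {perm A} is
   (s * t) a = t (s a).  The parameter R is the type of the values of the
   Hamming distance. *)
Definition Sym (R : realType) (A : finType) : Type := {perm A}.

Definition sym_fun (R : realType) (A : finType) (s : Sym R A) : A -> A :=
  (s : {perm A}).
Coercion sym_fun : Sym >-> Funclass.

Section Sym.
Context (R : realType) (A : finType).
Implicit Types s t u : Sym R A.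

HB.instance Definition _ := Finite.copy (Sym R A) {perm A}.

Definition sym_one : Sym R A := (1 : {perm A})%g.
Definition sym_inv s : Sym R A := ((s : {perm A})^-1)%g.
Definition sym_mul s t : Sym R A := ((t : {perm A}) * (s : {perm A}))%g.

Let sym_mulA : associative sym_mul.
Proof. by move=> s t u; rewrite /sym_mul mulgA. Qed.
Let sym_mul1 : left_id sym_one sym_mul.
Proof. by move=> s; exact: (@mulg1 {perm A}). Qed.
Let sym_mulr1 : right_id sym_one sym_mul.
Proof. by move=> s; exact: (@mul1g {perm A}). Qed.
Let sym_mulV : left_inverse sym_one sym_inv sym_mul.
Proof. by move=> s; exact: (@mulgV {perm A}). Qed.
Let sym_mulrV : right_inverse sym_one sym_inv sym_mul.
Proof. by move=> s; exact: (@mulVg {perm A}). Qed.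

HB.instance Definition _ := isGroup.Build (Sym R A)
  sym_mulA sym_mul1 sym_mulr1 sym_mulV sym_mulrV.

Lemma sym1E a : sym_fun (1%g : Sym R A) a = a.
Proof. exact: perm1. Qed.

Lemma symME s t a : sym_fun (s * t)%g a = s (t a).
Proof. exact: permM. Qed.

Lemma symK s : cancel s (sym_fun (s^-1)%g).
Proof. exact: permK. Qed.

Lemma symVK s : cancel (sym_fun (s^-1)%g) s.
Proof. exact: permKV. Qed.

Lemma Sym_card_pre s (P : pred A) : #|[pred a | P (s a)]| = #|P|.
Proof.
rewrite -(fintype.card_image (can_inj (symK s)) [pred a | P (s a)]); apply: eq_card => a.
apply/fintype.imageP/idP => [[b Pb ->]//|Pa]; exists (sym_fun (s^-1)%g a); last by rewrite symVK.
by rewrite inE symVK.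
Qed.

Definition sym_dist s t : R := hamming s t.

Let sym_distxx s : sym_dist s s = 0. Proof. exact: hammingxx. Qed.
Let sym_dist_pos s t : sym_dist s t = 0 -> s = t.
Proof. by move=> /hamming_eq0 st; apply/permP. Qed.
Let sym_distC s t : sym_dist s t = sym_dist t s. Proof. exact: hammingC. Qed.
Let sym_dist_tri t s u : sym_dist s u <= sym_dist s t + sym_dist t u.
Proof. exact: hamming_triangle. Qed.

HB.instance Definition _ := isMetric.Build R (Sym R A)
  sym_distxx sym_dist_pos sym_distC sym_dist_tri.

Lemma Sym_mdistE s t : mdist s t = hamming s t. Proof. by []. Qed.

Lemma Sym_mdist_le1 s t : mdist s t <= 1. Proof. exact: hamming_le1. Qed.

Lemma Sym_mdistMl u s t : mdist (u * s)%g (u * t)%g = mdist s t.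
Proof.
rewrite !Sym_mdistE; congr (_%:R / _); apply: eq_card => a.
by rewrite !inE !symME (can_eq (symK u)).
Qed.

Lemma Sym_mdistMr u s t : mdist (s * u)%g (t * u)%g = mdist s t.
Proof.
rewrite !Sym_mdistE; congr (_%:R / _).
by rewrite -[RHS](Sym_card_pre u); apply: eq_card => a; rewrite !inE !symME.
Qed.

Lemma Sym_mdistV s t : mdist (s^-1)%g (t^-1)%g = mdist s t.
Proof.
rewrite -(Sym_mdistMl s (s^-1)%g) mulgV -(Sym_mdistMr t 1%g) mul1g -mulgA mulVg.
by rewrite mulg1 metric_sym.
Qed.

End Sym.

(* The maps A -> T, metrized by the normalized Hamming distance. *)
Definition hmap (R : realType) (A : finType) (T : choiceType) : Type :=
  {ffun A -> T}.

Definition hmap_fun (R : realType) (A : finType) (T : choiceType)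
  (f : hmap R A T) : A -> T := (f : {ffun A -> T}).
Coercion hmap_fun : hmap >-> Funclass.

Section Hmap.
Context (R : realType) (A : finType) (T : choiceType).
Implicit Types f g h : hmap R A T.

HB.instance Definition _ := Choice.copy (hmap R A T) {ffun A -> T}.

Lemma hmapP f g : (forall a, f a = g a) -> f = g.
Proof. by move=> fg; apply/ffunP. Qed.

Definition hmap_dist f g : R := hamming f g.

Let hmap_distxx f : hmap_dist f f = 0. Proof. exact: hammingxx. Qed.
Let hmap_dist_pos f g : hmap_dist f g = 0 -> f = g.
Proof. by move=> /hamming_eq0 fg; apply/ffunP. Qed.
Let hmap_distC f g : hmap_dist f g = hmap_dist g f. Proof. exact: hammingC. Qed.
Let hmap_dist_tri g f h : hmap_dist f h <= hmap_dist f g + hmap_dist g h.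
Proof. exact: hamming_triangle. Qed.

HB.instance Definition _ := isMetric.Build R (hmap R A T)
  hmap_distxx hmap_dist_pos hmap_distC hmap_dist_tri.

Lemma hmap_mdistE f g : mdist f g = hamming f g. Proof. by []. Qed.

Lemma hmap_mdist_le1 f g : mdist f g <= 1. Proof. exact: hamming_le1. Qed.

Definition hmap_act (s : Sym R A) f : hmap R A T := [ffun a => f (sym_fun (s^-1)%g a)].

Lemma hmap_actE s f a : hmap_act s f a = f (sym_fun (s^-1)%g a).
Proof. by rewrite /hmap_act /hmap_fun ffunE. Qed.

Lemma hmap_act1 f : hmap_act 1%g f = f.
Proof. by apply: hmapP => a; rewrite hmap_actE invg1 sym1E. Qed.

Lemma hmap_actM s t f : hmap_act (s * t)%g f = hmap_act s (hmap_act t f).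
Proof. by apply: hmapP => a; rewrite !hmap_actE invgM symME. Qed.

Lemma hmap_mdist_act s f g : mdist (hmap_act s f) (hmap_act s g) = mdist f g.
Proof.
rewrite !hmap_mdistE; congr (_%:R / _).
rewrite -[RHS](Sym_card_pre (s^-1)%g).
by apply: eq_card => a; rewrite !inE !hmap_actE.
Qed.

Lemma hmap_mdist_actl s t f : mdist (hmap_act s f) (hmap_act t f) <= mdist s t.
Proof.
rewrite hmap_mdistE Sym_mdistE /hamming ler_wpM2r ?invr_ge0// ler_nat.
rewrite -[leqRHS](Sym_card_pre (s^-1)%g).
apply/subset_leq_card/fintype.subsetP => a.
rewrite !inE !hmap_actE symVK; apply: contra => /eqP e.
by rewrite {2}e symK.
Qed.

End Hmap.

Record free_ultrafilter (T : Type) := FreeUltrafilter {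
  ufilter :> set_system T ;
  ufilter_ultra : UltraFilter ufilter ;
  ufilter_free : \bigcap_(A in ufilter) A = set0 }.

#[global] Existing Instance ufilter_ultra.

Section MetricUltraproduct.
Context {R : realType} (U : free_ultrafilter nat) (X : nat -> metricType R).
Implicit Types f g h : forall n, X n.

Definition ueq f g : bool :=
  `[< mdist (f n) (g n) @[n --> ufilter U] --> (0 : R) >].

Let ueq_refl : reflexive ueq.
Proof.
move=> f; apply/asboolP.
under eq_fun do rewrite mdistxx.
exact: cvg_cst.
Qed.

Let ueq_sym : symmetric ueq.
Proof.
move=> f g; rewrite /ueq; congr (`[< _ >]).
by under eq_fun do rewrite metric_sym.
Qed.

Let ueq_trans : transitive ueq.
Proof.
move=> g f h /asboolP fg /asboolP gh; apply/asboolP.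
apply: (@squeeze_cvgr _ _ _ _ (fun=> 0)
  (fun n => mdist (f n) (g n) + mdist (g n) (h n))).
- by apply: nearW => n; rewrite mdist_ge0 metric_triangle.
- exact: cvg_cst.
- by rewrite -[X in _ --> X](addr0 (0 : R)); exact: cvgD.
Qed.

Canonical ueq_equiv := EquivRel ueq ueq_refl ueq_sym ueq_trans.

Definition metric_ultraproduct : Type := {eq_quot ueq_equiv}.

HB.instance Definition _ := Choice.on metric_ultraproduct.

Definition uclass f : metric_ultraproduct := \pi_({eq_quot ueq_equiv}) f.

Definition urepr (x : metric_ultraproduct) : forall n, X n :=
  repr (x : {eq_quot ueq_equiv}).

Lemma ureprK : cancel urepr uclass.
Proof. by move=> x; rewrite /uclass /urepr reprK. Qed.

Lemma uclass_surj x : exists f, x = uclass f.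
Proof. by exists (urepr x); rewrite ureprK. Qed.

Lemma uclassP f g : uclass f = uclass g <->
  mdist (f n) (g n) @[n --> ufilter U] --> (0 : R).
Proof.
split=> [/eqP|fg]; last by apply/eqP; rewrite eqmodE; apply/asboolP.
by rewrite eqmodE => /asboolP.
Qed.

Lemma eq_uclass f g : (forall n, f n = g n) -> uclass f = uclass g.
Proof.
by move=> fg; apply/uclassP; under eq_fun do rewrite fg mdistxx; exact: cvg_cst.
Qed.

Lemma urepr_uclass f :
  mdist (urepr (uclass f) n) (f n) @[n --> ufilter U] --> (0 : R).
Proof. by apply/uclassP; rewrite ureprK. Qed.

(* The limit exists when the metrics of the X n are uniformly bounded. *)
Definition udist (x y : metric_ultraproduct) : R :=
  lim (mdist (urepr x n) (urepr y n) @[n --> ufilter U]).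

Lemma is_cvg_mdist (C : R) f g : (forall n x y, mdist (x : X n) y <= C) ->
  cvg (mdist (f n) (g n) @[n --> ufilter U]).
Proof.
move=> dC; pose F : set_system R := mdist (f n) (g n) @[n --> ufilter U].
have FF : ProperFilter F by exact: fmap_proper_filter.
have FC : F `[0, C]%classic.
  by apply: nearW => n; rewrite /= in_itv/= mdist_ge0 dC.
have [l [_ clF]] := @segment_compact R 0 C F FF FC.
apply/cvg_ex; exists l => /= V lV.
have [//|FnV] := @in_ultra_setVsetC _ U (fun n => V (mdist (f n) (g n))) _.
by have [z []] := clF (~` V) V FnV lV.
Qed.

Lemma udistE (C : R) f g : (forall n x y, mdist (x : X n) y <= C) ->
  udist (uclass f) (uclass g) = lim (mdist (f n) (g n) @[n --> ufilter U]).
Proof.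
move=> dC; apply: cvg_lim => //.
set l := lim _.
have fgl : mdist (f n) (g n) @[n --> ufilter U] --> l by exact: is_cvg_mdist dC.
have e0 : mdist (urepr (uclass f) n) (f n) + mdist (urepr (uclass g) n) (g n)
    @[n --> ufilter U] --> (0 : R).
  by rewrite -[X in _ --> X](addr0 (0 : R)); apply: cvgD; exact: urepr_uclass.
apply: (@squeeze_cvgr _ _ _ _
  (fun n => mdist (f n) (g n) - (mdist (urepr (uclass f) n) (f n) +
     mdist (urepr (uclass g) n) (g n)))
  (fun n => mdist (f n) (g n) + (mdist (urepr (uclass f) n) (f n) +
     mdist (urepr (uclass g) n) (g n)))).
- apply: nearW => n; set f' := urepr _ n; set g' := urepr _ n.
  have := metric_triangle (f n) f' (g n); have := metric_triangle f' g' (g n).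
  have := metric_triangle f' (f n) g'; have := metric_triangle (f n) (g n) g'.
  rewrite (metric_sym (f n) f') (metric_sym (g n) g').
  by move=> h1 h2 h3 h4; apply/andP; split; lra.
- by rewrite -[X in _ --> X](subr0 l); exact: cvgB.
- by rewrite -[X in _ --> X](addr0 l); exact: cvgD.
Qed.

End MetricUltraproduct.

Arguments uclass {R U X} f.
Arguments urepr {R U X} x n.
Arguments udist {R U X} x y.

(* Index n : nat stands for the positive integer n.+1, so that 'I_n.+1 is the
   set [n+1] and the sequences below are indexed by the positive integers. *)
Definition universal_sofic_group (R : realType) (U : free_ultrafilter nat) : Type :=
  metric_ultraproduct U (fun n => Sym R 'I_n.+1).

Definition universal_sofic_space (R : realType) (U : free_ultrafilter nat) : Type :=
  metric_ultraproduct U (fun n => hmap R 'I_n.+1 nat).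

Section UniversalSofic.
Context {R : realType} {U : free_ultrafilter nat}.
Local Notation SU := (universal_sofic_group R U).
Local Notation XU := (universal_sofic_space R U).
Implicit Types (x y z : SU) (f g : forall n, Sym R 'I_n.+1).
Implicit Types (p q : forall n, hmap R 'I_n.+1 nat).

HB.instance Definition _ := Choice.on SU.
HB.instance Definition _ := Choice.on XU.

Definition usg_one : SU := uclass (fun n => 1%g : Sym R 'I_n.+1).
Definition usg_inv x : SU := uclass (fun n => (urepr x n)^-1 : Sym R 'I_n.+1)%g.
Definition usg_mul x y : SU := uclass (fun n => urepr x n * urepr y n : Sym R 'I_n.+1)%g.

Let usg_mulE f g :
  usg_mul (uclass f) (uclass g) = uclass (fun n => f n * g n : Sym R 'I_n.+1)%g.
Proof.
apply/uclassP; apply: (@squeeze_cvgr _ _ _ _ (fun=> 0)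
  (fun n => mdist (urepr (uclass f : SU) n) (f n) +
            mdist (urepr (uclass g : SU) n) (g n))).
- apply: nearW => n; rewrite mdist_ge0/=.
  apply: le_trans (metric_triangle _ (f n * urepr (uclass g : SU) n)%g _) _.
  by rewrite Sym_mdistMl Sym_mdistMr.
- exact: cvg_cst.
- by rewrite -[X in _ --> X](addr0 (0 : R)); apply: cvgD; exact: urepr_uclass.
Qed.

Let usg_invE f : usg_inv (uclass f) = uclass (fun n => (f n)^-1 : Sym R 'I_n.+1)%g.
Proof.
apply/uclassP; under eq_fun do rewrite Sym_mdistV.
exact: urepr_uclass.
Qed.

Let usg_mulA : associative usg_mul.
Proof.
move=> x y z; have [f ->] := uclass_surj x; have [g ->] := uclass_surj y.
have [h ->] := uclass_surj z.
rewrite (usg_mulE g h) (usg_mulE f g) !usg_mulE.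
by apply: eq_uclass => n; rewrite mulgA.
Qed.
Let usg_mul1 : left_id usg_one usg_mul.
Proof.
move=> x; have [f ->] := uclass_surj x; rewrite usg_mulE.
by apply: eq_uclass => n; rewrite mul1g.
Qed.
Let usg_mulr1 : right_id usg_one usg_mul.
Proof.
move=> x; have [f ->] := uclass_surj x; rewrite usg_mulE.
by apply: eq_uclass => n; rewrite mulg1.
Qed.
Let usg_mulV : left_inverse usg_one usg_inv usg_mul.
Proof.
move=> x; have [f ->] := uclass_surj x; rewrite usg_invE usg_mulE.
by apply: eq_uclass => n; rewrite mulVg.
Qed.
Let usg_mulrV : right_inverse usg_one usg_inv usg_mul.
Proof.
move=> x; have [f ->] := uclass_surj x; rewrite usg_invE usg_mulE.
by apply: eq_uclass => n; rewrite mulgV.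
Qed.

HB.instance Definition _ := isGroup.Build SU
  usg_mulA usg_mul1 usg_mulr1 usg_mulV usg_mulrV.

Lemma uclass1 : (1%g : SU) = uclass (fun n => 1%g : Sym R 'I_n.+1). Proof. by []. Qed.

Lemma uclassM f g :
  ((uclass f : SU) * (uclass g : SU))%g = uclass (fun n => f n * g n : Sym R 'I_n.+1)%g.
Proof. exact: usg_mulE. Qed.

Lemma uclassV f : ((uclass f : SU)^-1)%g = uclass (fun n => (f n)^-1 : Sym R 'I_n.+1)%g.
Proof. exact: usg_invE. Qed.

Definition universal_sofic_action (x : SU) (v : XU) : XU :=
  uclass (fun n => hmap_act (urepr x n) (urepr v n)).

Lemma universal_sofic_actionE f p :
  universal_sofic_action (uclass f) (uclass p) =
  uclass (fun n => hmap_act (f n) (p n)).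
Proof.
apply/uclassP; apply: (@squeeze_cvgr _ _ _ _ (fun=> 0)
  (fun n => mdist (urepr (uclass f : SU) n) (f n) +
            mdist (urepr (uclass p : XU) n) (p n))).
- apply: nearW => n; rewrite mdist_ge0/=.
  apply: le_trans
    (metric_triangle _ (hmap_act (f n) (urepr (uclass p : XU) n)) _) _.
  by rewrite lerD// ?hmap_mdist_act// hmap_mdist_actl.
- exact: cvg_cst.
- by rewrite -[X in _ --> X](addr0 (0 : R)); apply: cvgD; exact: urepr_uclass.
Qed.

End UniversalSofic.

Definition group_action (G : groupType) (X : Type) (alpha : G -> X -> X) : Prop :=
  (forall x, alpha 1%g x = x) /\
  (forall g h x, alpha (g * h)%g x = alpha g (alpha h x)).

Lemma universal_sofic_action_is_action (R : realType) (U : free_ultrafilter nat) :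
  group_action (@universal_sofic_action R U).
Proof.
split=> [v|x y v]; have [p ->] := uclass_surj v.
  by rewrite uclass1 universal_sofic_actionE; apply: eq_uclass => n /=;
    rewrite hmap_act1.
have [f ->] := uclass_surj x; have [g ->] := uclass_surj y.
rewrite uclassM (universal_sofic_actionE g p) !universal_sofic_actionE.
by apply: eq_uclass => n /=; rewrite hmap_actM.
Qed.

Section Sofic.
Context {R : realType} {G : groupType} {X : Type} (alpha : G -> X -> X).

Definition unital_map (A : finType) (phi : G -> Sym R A) : Prop :=
  phi 1%g = 1%g.

Definition approx_multiplicative (F : set G) (eps : R)
    (A : finType) (phi : G -> Sym R A) : Prop :=
  forall g h, F g -> F h -> mdist (phi (g * h)%g) (phi g * phi h)%g < eps.

(* Only the values pi s x with s \in S and x in E matter: pi s stands for an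
   injection of E into B. *)
Definition orbit_approximation (F : set G) (E : set X) (eps : R)
    (A : finType) (phi : G -> Sym R A) : Prop :=
  exists (B : finType) (S : {set A}) (pi : A -> X -> B),
    [/\ (1 - eps) * #|A|%:R < #|S|%:R,
        forall s, s \in S -> set_inj E (pi s) &
        forall s g x, s \in S -> F g -> E x ->
          phi g s \in S -> E (alpha (g^-1)%g x) ->
          pi (phi g s) x = pi s (alpha (g^-1)%g x)].

End Sofic.

Definition sofic_action (R : realType) (G : groupType) (X : Type)
    (alpha : G -> X -> X) : Prop :=
  forall (F : set G) (E : set X) (eps : R),
    finite_set F -> finite_set E -> 0 < eps ->
    exists (A : finType) (phi : G -> Sym R A),
      [/\ (0 < #|A|)%N, unital_map phi, approx_multiplicative F eps phi &
          orbit_approximation alpha F E eps phi].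

(* Main.v *)
(* A sofic approximation on a finite set A can be amplified to A * K without
   changing any Hamming distance, so approximations of every quality exist on
   arbitrarily large sets [m].  The sets D n of those m >= n that carry an
   approximation of quality n are nonempty and decreasing, hence belong to a
   common free ultrafilter; taking on each [m] the best available approximation
   gives the maps into the ultraproducts.
   Conversely, lift the maps from the ultraproducts to sequences.  The subsets of
   the disjoint union of the [n] whose density tends to 1 along U form a filter,
   and for given finite F and E the finitely many equivariance and separation
   conditions hold on a member of it; its section in [n], for a suitable n, is the
   set S of an orbit approximation. *)
Require Import Defs.
From HB Require Import structures.
From mathcomp Require Import all_boot all_order all_algebra all_fingroup.
From mathcomp Require Import lra zify.
From mathcomp Require Import all_classical all_reals all_analysis.

Set Implicit Arguments.
Unset Strict Implicit.
Unset Printing Implicit Defensive.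

Import Order.TTheory GRing.Theory Num.Theory.
Import numFieldNormedType.Exports.

Local Open Scope classical_set_scope.
Local Open Scope ring_scope.

(* perm.Sym, the set of permutations with a given support, hides Defs.Sym. *)
Local Notation Sym := Defs.Sym.

Lemma near_finite_forall (T I : Type) (F : set_system T) (D : set I)
    (P : I -> T -> Prop) {FF : Filter F} :
  finite_set D -> (forall i, D i -> \forall t \near F, P i t) ->
  \forall t \near F, forall i, D i -> P i t.
Proof.
(* Finite intersections of filter sets need a choice structure on the indices; [{classic I}]
   provides one. *)
suff H (J : choiceType) (E : set J) (Q : J -> T -> Prop) :
    finite_set E -> (forall i, E i -> F (Q i)) ->
    F (fun t => forall i, E i -> Q i t) by exact: (H {classic I}).
move=> /finite_fsetP[d ->] FQ.
exact: (filter_bigI FF).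
Qed.

(** * The uniform measure on a finite set *)

Section Density.
Context {R : realType} {A : finType}.
Implicit Types P Q : pred A.

Definition density P : R := #|P|%:R / #|A|%:R.

Lemma eq_density P Q : P =1 Q -> density P = density Q.
Proof. by move=> PQ; rewrite /density (eq_card PQ). Qed.

Lemma le_density P Q : (forall a, P a -> Q a) -> density P <= density Q.
Proof.
move=> PQ; rewrite /density ler_wpM2r ?invr_ge0// ler_nat.
exact/subset_leq_card/fintype.subsetP.
Qed.

Lemma density0 : density pred0 = 0.
Proof. by rewrite /density card0 mul0r. Qed.

Lemma densityU P Q : density [predU P & Q] <= density P + density Q.
Proof.
by rewrite /density -mulrDl ler_wpM2r ?invr_ge0// -natrD ler_nat -cardUI leq_addr.
Qed.

Lemma densityC P : (0 < #|A|)%N -> density P + density [predC P] = 1.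
Proof.
move=> A0; rewrite /density -mulrDl -natrD cardC divff// pnatr_eq0.
by rewrite -lt0n.
Qed.

Lemma density_sym (s : Sym R A) P : density [pred a | P (s a)] = density P.
Proof. by rewrite /density Sym_card_pre. Qed.

Lemma hamming_density (T : eqType) (f g : A -> T) :
  hamming f g = density [pred a | f a != g a].
Proof. by []. Qed.

End Density.

Lemma Sym_eq (R : realType) (A : finType) (s t : Sym R A) : s =1 t -> s = t.
Proof. by move=> st; apply/permP => a; exact: st. Qed.

(** * Amplification of permutations to a product set *)

Section Amplification.
Context {R : realType} {A K I : finType} (e : I -> A * K) (d : A * K -> I).
Hypotheses (eK : cancel e d) (dK : cancel d e).

Lemma amplify_inj (s : Sym R A) : injective (fun i => d (s (e i).1, (e i).2)).
Proof.
move=> i j /(can_inj dK)[/perm_inj eij1 eij2]; apply: (can_inj eK).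
by rewrite [e i]surjective_pairing [e j]surjective_pairing eij1 eij2.
Qed.

(** The permutation acts by [s] on [A] and trivially on [K], transported along the bijection [e] so
    that [I] may be an ordinal type. *)
Definition amplify (s : Sym R A) : Sym R I := perm (@amplify_inj s).

Lemma amplifyE s i : e (amplify s i) = (s (e i).1, (e i).2).
Proof. by rewrite /sym_fun permE dK. Qed.

Lemma amplify1 : amplify 1%g = 1%g.
Proof.
by apply: Sym_eq => i; apply: (can_inj eK); rewrite amplifyE !sym1E -surjective_pairing.
Qed.

Lemma amplifyM s t : amplify (s * t)%g = (amplify s * amplify t)%g.
Proof.
by apply: Sym_eq => i; apply: (can_inj eK); rewrite !(symME, amplifyE).
Qed.

(** Each point of [A] has exactly [#|K|] preimages in [I]. Applied to disagreement sets, this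
    preserves Hamming distances. *)
Lemma density_amplify (P : pred A) : (0 < #|K|)%N ->
  density [pred i | P (e i).1] = density P :> R.
Proof.
move=> K0; have cI : #|I| = (#|A| * #|K|)%N.
  by rewrite -card_prod; apply: (bij_eq_card (f := e)); exists d.
pose P' : pred I := [pred i | P (e i).1].
have cP : #|P'| = (#|P| * #|K|)%N.
  rewrite -cardX -(fintype.card_image (can_inj dK)); apply: eq_card => i.
  apply/idP/fintype.imageP => [Pi|[[a k]]].
    by exists (e i); rewrite ?eK// !inE andbT.
  by rewrite !inE andbT => Pa ->; rewrite dK.
rewrite -/P' /density cP cI !natrM -mulf_div divff ?mulr1// pnatr_eq0; lia.
Qed.

End Amplification.

(** * Finite approximations by permutations and labelings *)

Section Approximation.
Context {R : realType} {G : groupType} {X : Type} (alpha : G -> X -> X).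

(* At a, the equivariance condition compares p x (phi g a) with p (alpha g^-1 x) a,
   as an orbit approximation does. *)
Definition approximates (F : set G) (E : set X) (eps : R) (A : finType)
    (phi : G -> Sym R A) (p : X -> hmap R A nat) : Prop :=
  [/\ unital_map phi, approx_multiplicative F eps phi,
      forall g x, F g -> E x -> E (alpha g^-1%g x) ->
        mdist (hmap_act (phi g)^-1%g (p x)) (p (alpha g^-1%g x)) < eps &
      forall x y, E x -> E y -> x <> y -> 1 - eps < mdist (p x) (p y)].

Lemma approximatesS (F F' : set G) (E E' : set X) (eps eps' : R) (A : finType)
    (phi : G -> Sym R A) (p : X -> hmap R A nat) :
  F' `<=` F -> E' `<=` E -> eps <= eps' ->
  approximates F E eps phi p -> approximates F' E' eps' phi p.
Proof.
move=> F'F E'E le_eps [phi1 phiM phip pD]; split=> //.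
- by move=> g h /F'F Fg /F'F Fh; exact: lt_le_trans (phiM _ _ Fg Fh) le_eps.
- move=> g x /F'F Fg /E'E Ex /E'E Egx; exact: lt_le_trans (phip _ _ Fg Ex Egx) le_eps.
- move=> x y /E'E Ex /E'E Ey xy; apply: le_lt_trans (pD x y Ex Ey xy).
  by rewrite lerD2l lerN2.
Qed.

Lemma sofic_approximates (F : set G) (E : set X) (eps : R) (N : nat) :
  sofic_action R alpha -> finite_set F -> finite_set E -> 0 < eps ->
  exists m, (N <= m)%N /\
    exists (phi : G -> Sym R 'I_m.+1) (p : X -> hmap R 'I_m.+1 nat),
      approximates F E eps phi p.
Proof.
(* Equivariance can fail at [a] when [a] or [phi g a] lies outside [S]; each event is given density
   below [eps / 2]. *)
move=> sofic finF finE eps0; have eps20 : 0 < eps / 2 by rewrite divr_gt0.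
have [A [phi [A0 phi1 phiM [B [S [pi [cS piI piE]]]]]]] :=
  sofic F E (eps / 2) finF finE eps20.
have dS : density [predC S] < eps / 2.
  have := @densityC R A (mem S) A0; rewrite {1}/density.
  move: cS; rewrite -ltr_pdivlMr ?ltr0n// => cS.
  rewrite (@eq_density R A [predC mem S] [predC S])//; move: cS; lra.
(* The predecessor is taken because the index [m] stands for a set of [m.+1] points. *)
pose T : finType := (A * 'I_N.+1)%type; pose m := #|T|.-1.
have cT : m.+1 = #|T| by rewrite /m card_prod card_ord; move: A0; lia.
have Nm : (N <= m)%N by rewrite /m card_prod card_ord; move: A0; nia.
pose e (i : 'I_m.+1) : T := enum_val (cast_ord cT i).
pose d (t : T) : 'I_m.+1 := cast_ord (esym cT) (enum_rank t).
have eK : cancel e d by move=> i; rewrite /d /e enum_valK cast_ordK.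
have dK : cancel d e by move=> i; rewrite /d /e cast_ordKV enum_rankK.
have K0 : (0 < #|'I_N.+1|)%N by rewrite card_ord.
exists m; split=> //.
pose amp : Sym R A -> Sym R 'I_m.+1 := amplify eK dK.
have ampE s i : (e (amp s i)).1 = s (e i).1 by rewrite amplifyE.
exists (fun g => amp (phi g)).
(* Elements of [B] are coded in [nat] by their rank; the label ignores the second coordinate. *)
exists (fun x => [ffun i => nat_of_ord (enum_rank (pi (e i).1 x))]).
split.
- by rewrite /unital_map phi1; exact: amplify1.
- move=> g h Fg Fh; rewrite /amp -amplifyM Sym_mdistE.
  rewrite hamming_density.
  rewrite (@eq_density _ _ _ [pred i |
      [pred a | phi (g * h)%g a != (phi g * phi h)%g a] (e i).1]).
    rewrite (density_amplify eK dK)//.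
    have := phiM g h Fg Fh; rewrite Sym_mdistE hamming_density => H.
    by apply: lt_le_trans H _; lra.
  move=> i /=; rewrite -(inj_eq (can_inj eK)) !amplifyE xpair_eqE eqxx.
  by rewrite andbT.
- move=> g x Fg Ex Egx; rewrite hmap_mdistE hamming_density.
  apply: le_lt_trans
    (_ : density [predU [predC S] & [pred a | [predC S] (phi g a)]] < eps).
    rewrite -(density_amplify eK dK _ K0); apply: le_density => i /=.
    apply: contraR; rewrite !inE negb_or !negbK => /andP[iS giS].
    rewrite hmap_actE invgK /hmap_fun !ffunE ampE.
    by rewrite (piE _ _ _ iS Fg Ex giS Egx).
  by apply: le_lt_trans (densityU _ _) _; rewrite density_sym; lra.
- move=> x y Ex Ey xy; rewrite hmap_mdistE hamming_density.
  rewrite ltrBlDr.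
  apply: (@lt_le_trans _ _ (density (mem S) + eps : R)).
    have := @densityC R A (mem S) A0; move: dS.
    rewrite (@eq_density R A [predC mem S] [predC S])//; lra.
  rewrite lerD2r -(density_amplify eK dK _ K0); apply: le_density => i /= iS.
  rewrite /hmap_fun !ffunE (inj_eq val_inj) (inj_eq enum_rank_inj).
  by apply: contra_notN xy => /eqP/piI; apply; rewrite ?inE.
Qed.

End Approximation.

(** * Limits and distances along an ultrafilter *)

Section LimitsAlongUltrafilters.
Context {R : realType} (U : free_ultrafilter nat).

Lemma cvg0_near (u : nat -> R) : (forall n, 0 <= u n) ->
  (u n @[n --> ufilter U] --> (0 : R)) <->
  (forall eps, 0 < eps -> \forall n \near ufilter U, u n < eps).
Proof.
move=> u0; rewrite cvgr0Pnorm_lt; split=> uU eps /uU;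
  by apply: filterS => n; rewrite ger0_norm.
Qed.

(** The bound 1 makes the distances converge along [U] and keeps [1 - mdist] nonnegative, so limit 1
    amounts to [1 - mdist] tending to 0. *)
Lemma udist_eq1 (X : nat -> metricType R) (f g : forall n, X n) :
  (forall n (x y : X n), mdist x y <= 1) ->
  udist (uclass f : metric_ultraproduct U X) (uclass g) = 1 <->
  (forall eps, 0 < eps -> \forall n \near ufilter U, 1 - eps < mdist (f n) (g n)).
Proof.
move=> X1; rewrite (udistE U f g X1); have cfg := @is_cvg_mdist _ U _ _ f g X1.
have -> : lim (mdist (f n) (g n) @[n --> ufilter U]) = 1 <->
    (1 - mdist (f n) (g n) @[n --> ufilter U] --> (0 : R)).
  split=> [fg1|fg0].
    rewrite -[X in _ --> X](subrr (1 : R)); apply: cvgB; first exact: cvg_cst.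
    by rewrite -[X in _ --> X]fg1.
  apply: cvg_lim => //; rewrite -[X in _ --> X](subr0 1).
  under eq_fun do rewrite -[mdist _ _](subKr 1).
  by apply: cvgB; first exact: cvg_cst.
rewrite cvg0_near => [|n]; last by rewrite subr_ge0.
by split=> fg eps /fg; apply: filterS => n; lra.
Qed.

End LimitsAlongUltrafilters.

(** * From soficity to the ultraproducts *)

Lemma free_ultrafilter_of_base (D : nat -> set nat) :
  (forall n, D n !=set0) -> (forall n, D n `<=` [set m | (n <= m)%N]) ->
  (forall n n', (n <= n')%N -> D n' `<=` D n) ->
  exists U : free_ultrafilter nat, forall n, ufilter U (D n).
Proof.
move=> D0 Dge Ddecr.
have FD : Filter (filter_from setT D).
  apply: filter_from_filter; first by exists 0%N.
  move=> i j _ _; exists (maxn i j) => // m Dm.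
  by split; apply: (Ddecr _ (maxn i j)); rewrite ?leq_maxl ?leq_maxr.
have PD : ProperFilter (filter_from setT D) by apply: filter_from_proper.
have [V [uV DV]] := ultraFilterLemma PD.
have VD n : V (D n) by apply: DV; exists n.
suff freeV : \bigcap_(A in V) A = set0 by exists (FreeUltrafilter uV freeV).
(* Freeness: [m] cannot lie in [D m.+1], whose elements are at least [m.+1]. *)
apply/seteqP; split=> // m /(_ (D m.+1) (VD _)) /Dge /=.
by rewrite ltnn.
Qed.

Lemma sofic_ultraproduct (R : realType) (G : groupType) (X : Type)
    (alpha : G -> X -> X) :
  countable [set: G] -> countable [set: X] -> sofic_action R alpha ->
  exists (U : free_ultrafilter nat)
         (phi : {multiplicative G -> universal_sofic_group R U})
         (pi : X -> universal_sofic_space R U),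
    (forall (x : X) (g : G),
       universal_sofic_action (phi g) (pi x) = pi (alpha g x)) /\
    (forall x y : X, x <> y -> udist (pi x) (pi y) = 1).
Proof.
move=> G_countable X_countable sofic.
have exhaustion (T : Type) : countable [set: T] -> exists B : nat -> set T,
    [/\ forall n, finite_set (B n), forall n n', (n <= n')%N -> B n `<=` B n' &
        forall t, \forall n \near \oo, B n t].
  move=> /countable_injP[c cI]; exists (fun n => c @^-1` `I_n); split.
  - by move=> n; apply: finite_preimage (finite_II n) => x y _ _; apply: cI; rewrite inE.
  - by move=> n n' nn' t /= ?; exact: leq_trans nn'.
  - by move=> t; exact: nbhs_infty_gt.
have [F [finF leF nearF]] := exhaustion _ G_countable.
have [E [finE leE nearE]] := exhaustion _ X_countable.
pose good n m (phi : G -> Sym R 'I_m.+1) (p : X -> hmap R 'I_m.+1 nat) :=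
  approximates alpha (F n) (E n) n.+1%:R^-1 phi p.
have goodS n n' m phi p : (n <= n')%N -> good n' m phi p -> good n m phi p.
  move=> nn'; apply: approximatesS; [exact: leF|exact: leE|].
  by rewrite lef_pV2 ?posrE// ler_nat.
pose D n := [set m | (n <= m)%N /\ exists phi p, good n m phi p].
(* The [n] with [m] in [D n] are bounded by [m]; if there are any, an approximation for the largest
   serves all of them by [goodS]. Otherwise a dummy value is used. *)
have best m : {q : (G -> Sym R 'I_m.+1) * (X -> hmap R 'I_m.+1 nat) |
    forall n, D n m -> good n m q.1 q.2}.
  apply: cid; have [[n Dn]|noD] := pselect (exists n, D n m); last first.
    exists (fun=> 1%g, fun=> [ffun=> 0%N]) => n Dn; exfalso; apply: noD; by exists n.
  have [||k /asboolP[_ [phi [p kgood]]] kmax] := @ex_maxnP (fun n => `[< D n m >]) m.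
  - by exists n; apply/asboolP.
  - by move=> i /asboolP[].
  exists (phi, p) => n' Dn'; apply: goodS kgood; apply: kmax; exact/asboolP.
have [U UD] : exists U : free_ultrafilter nat, forall n, ufilter U (D n).
  apply: free_ultrafilter_of_base => [n|n m []//|n n' nn' m [n'm [phi [p pgood]]]].
    have [m Dm] := sofic_approximates n sofic (finF n) (finE n)
      (ltac:(by rewrite invr_gt0 ltr0n) : 0 < n.+1%:R^-1 :> R).
    by exists m.
  by split; [exact: leq_trans n'm|exists phi, p; exact: goodS pgood].
pose f g m : Sym R 'I_m.+1 := (sval (best m)).1 g.
pose p x m : hmap R 'I_m.+1 nat := (sval (best m)).2 x.
have Ugood n : \forall m \near ufilter U, good n m (f^~ m) (p^~ m).
  by apply: filterS (UD n) => m; exact: (svalP (best m)).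
have near_small eps : 0 < eps -> \forall n \near \oo, n.+1%:R^-1 < eps :> R.
  by move=> eps0; exact: (near_infty_natSinv_lt (PosNum eps0)).
pose phi g : universal_sofic_group R U := uclass (f g).
pose pi x : universal_sofic_space R U := uclass (p x).
have phiM : {morph phi : g h / (g * h)%g}.
  move=> g h; rewrite /phi uclassM; apply/(uclassP U)/cvg0_near => [?|eps eps0].
    exact: mdist_ge0.
  (* First [n] is fixed, large with respect to [eps], [g] and [h]; the estimate then holds for
     [U]-almost all [m]. *)
  near \oo => n; apply: filterS (Ugood n) => m [_ fM _ _].
  apply: (@lt_trans _ _ n.+1%:R^-1); last by near: n; exact: near_small.
  by apply: fM; near: n; exact: nearF.
have phi1 : phi 1%g = 1%g by apply: (mulgI (phi 1%g)); rewrite -phiM !mulg1.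
pose phi_mul := isMultiplicative.Build _ _ phi phiM.
pose phiH : {multiplicative G -> universal_sofic_group R U} := HB.pack phi phi_mul.
exists U, phiH, pi; split=> [x g|x y xy].
  (* [approximates] controls the inverse of the permutation attached to a group element, so it is
     applied to [g^-1]. *)
  have -> : phiH g = (phi g^-1%g)^-1%g.
    by apply: (mulIg (phi g^-1%g)); rewrite mulVg -phiM mulgV phi1.
  rewrite uclassV universal_sofic_actionE.
  apply/(uclassP U)/cvg0_near => [?|eps eps0]; first exact: mdist_ge0.
  near \oo => n; apply: filterS (Ugood n) => m [_ _ fp _].
  apply: (@lt_trans _ _ n.+1%:R^-1); last by near: n; exact: near_small.
  have := fp g^-1%g x; rewrite invgK; apply; near: n; [exact: nearF|exact: nearE..].
apply/udist_eq1 => [n ? ?|eps eps0]; first exact: hmap_mdist_le1.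
near \oo => n; apply: filterS (Ugood n) => m [_ _ _ pD].
apply: (@lt_trans _ _ (1 - n.+1%:R^-1)).
  by rewrite ltrD2l ltrN2; near: n; exact: near_small.
by apply: pD => //; near: n; exact: nearE.
Unshelve. all: by end_near.
Qed.

(** * From the ultraproducts to soficity *)

Section AsymptoticallyAlmostEverywhere.
Context (R : realType) (U : free_ultrafilter nat).

(** Measuring complements reduces closure under intersection to subadditivity of the density.
    Conditions on points can then be combined as filter statements. *)
Definition aae : set_system {n & 'I_n.+1} := [set Q |
  forall eps : R, 0 < eps -> \forall n \near ufilter U,
    density [pred a : 'I_n.+1 | ~~ `[< Q (Tagged (fun n => 'I_n.+1) a) >]] < eps].

#[global] Instance aae_filter : Filter aae.
Proof.
split=> [eps eps0|P Q aP aQ eps eps0|P Q PQ aP eps eps0].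
- apply: nearW => n; apply: le_lt_trans eps0; rewrite -(@density0 R 'I_n.+1).
  by apply: le_density => a /= /asboolPn[].
- have eps20 : 0 < eps / 2 by rewrite divr_gt0.
  apply: filterS (filterI (aP _ eps20) (aQ _ eps20)) => n [dP dQ].
  apply: (@le_lt_trans _ _ (density _ + density _)); last first.
    by rewrite (splitr eps); exact: ltrD dP dQ.
  apply: le_trans (densityU _ _); apply: le_density => a /=.
  by rewrite asbool_and negb_and.
- apply: filterS (aP _ eps0) => n; apply: le_lt_trans.
  by apply: le_density => a /=; apply: contraNN => /asboolP/PQ/asboolP.
Qed.

Lemma uclass_eq_aae (p q : forall n, hmap R 'I_n.+1 nat) :
  uclass p = uclass q :> universal_sofic_space R U ->
  \forall a \near aae, p (tag a) (tagged a) = q (tag a) (tagged a).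
Proof.
move=> /(uclassP U)/cvg0_near pq eps eps0.
apply: filterS (pq _ eps eps0) => [n|n]; last exact: mdist_ge0.
by apply: le_lt_trans; apply: le_density => a /=; apply: contraNN => /eqP/asboolP.
Qed.

(** A distance close to 1 leaves an agreement set of small density. *)
Lemma udist_eq1_aae (p q : forall n, hmap R 'I_n.+1 nat) :
  udist (uclass p : universal_sofic_space R U) (uclass q) = 1 ->
  \forall a \near aae, p (tag a) (tagged a) <> q (tag a) (tagged a).
Proof.
move=> /udist_eq1 pq eps eps0.
apply: filterS (pq _ eps eps0) => [n|n ? ?]; last exact: hmap_mdist_le1.
rewrite hmap_mdistE hamming_density.
have := @densityC R _ [pred a | p n a != q n a] (ltac:(by rewrite card_ord)).
move=> pqC pq1; apply: (@le_lt_trans _ _ (density [predC [pred a | p n a != q n a]])).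
  by apply: le_density => a /=; apply: contraNN => /eqP/asboolP.
move: pqC pq1; lra.
Qed.

End AsymptoticallyAlmostEverywhere.

Lemma ultraproduct_sofic (R : realType) (G : groupType) (X : Type)
    (alpha : G -> X -> X) (U : free_ultrafilter nat)
    (phi : {multiplicative G -> universal_sofic_group R U})
    (pi : X -> universal_sofic_space R U) :
  (forall (x : X) (g : G),
     universal_sofic_action (phi g) (pi x) = pi (alpha g x)) ->
  (forall x y : X, x <> y -> udist (pi x) (pi y) = 1) ->
  sofic_action R alpha.
Proof.
move=> pi_act pi_dist F E eps finF finE eps0.
have phi1 : phi 1%g = 1%g by apply: (mulgI (phi 1%g)); rewrite -gmulfM !mulg1.
(* The chosen representative of phi 1 need not be unital. *)
pose f g n : Sym R 'I_n.+1 := if g == 1%g then 1%g else urepr (phi g) n.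
pose p x n : hmap R 'I_n.+1 nat := urepr (pi x) n.
have phiE g : phi g = uclass (f g).
  rewrite /f; case: eqVneq => [->|_]; first by rewrite phi1 uclass1.
  by rewrite (ureprK (phi g)).
have piE x : pi x = uclass (p x) by rewrite /p (ureprK (pi x)).
(* Multiplicativity concerns whole permutations rather than points, hence is stated along [U]. *)
have fM : \forall n \near ufilter U, forall gh, (F `*` F) gh ->
    mdist (f (gh.1 * gh.2)%g n) (f gh.1 n * f gh.2 n)%g < eps.
  apply: near_finite_forall; first exact: finite_setX.
  move=> [g h] _ /=; apply: (cvg0_near _ _).1 => //; first by move=> ?; exact: mdist_ge0.
  by apply/(uclassP U); rewrite -uclassM -!phiE gmulfM.
pose sep (a : {n & 'I_n.+1}) := forall xy, (E `*` E) xy -> xy.1 <> xy.2 ->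
  p xy.1 (tag a) (tagged a) <> p xy.2 (tag a) (tagged a).
pose equiv (a : {n & 'I_n.+1}) := forall gx, (F `*` E) gx ->
  p gx.2 (tag a) (f gx.1 (tag a) (tagged a)) =
  p (alpha gx.1^-1%g gx.2) (tag a) (tagged a).
have aae_sep : \forall a \near aae R U, sep a.
  apply: near_finite_forall; first exact: finite_setX.
  move=> [x y] _ /=; have [->|xy] := pselect (x = y); first by apply: nearW => a [].
  have := pi_dist x y xy; rewrite !piE => /udist_eq1_aae.
  by move=> pxy; refine (filterS _ pxy) => a ? _.
have aae_equiv : \forall a \near aae R U, equiv a.
  apply: near_finite_forall; first exact: finite_setX.
  (* Equivariance is used at [g^-1]: the inverse of [f g] acts by precomposition with [f g], as in
     [equiv]. *)
  move=> [g x] _ /=; have := pi_act x g^-1%g.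
  have -> : phi g^-1%g = (phi g)^-1%g.
    by apply: (mulIg (phi g)); rewrite -gmulfM !mulVg.
  rewrite phiE !piE uclassV universal_sofic_actionE => /uclass_eq_aae.
  by move=> pgx; refine (filterS _ pgx) => a; rewrite hmap_actE invgK.
(* One [n] is chosen at which multiplicativity holds and the points failing [sep] or [equiv] have
   density below [eps]. *)
have [n [fMn dS]] := filter_ex (filterI fM (filterI aae_sep aae_equiv eps eps0)).
exists 'I_n.+1, (f^~ n); split.
- by rewrite card_ord.
- by rewrite /unital_map /f eqxx.
- by move=> g h Fg Fh; exact: (fMn (g, h)).
(* The target [B] must be finite: the finitely many labels of points of [E] on ['I_n.+1] have a
   common bound. *)
have [M pM] : exists M, forall ax, ([set: 'I_n.+1] `*` E) ax ->
    (p ax.2 n ax.1 <= M)%N.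
  suff /filter_ex[M pM] : \forall M \near \oo, forall ax, ([set: 'I_n.+1] `*` E) ax ->
      (p ax.2 n ax.1 <= M)%N by exists M.
  apply: near_finite_forall; first exact: finite_setX.
  by move=> ax _; exact: nbhs_infty_ge.
pose S := finset (fun a : 'I_n.+1 => `[< sep (existT _ n a) /\ equiv (existT _ n a) >]).
(* [inord] is faithful up to [M], hence on the labels of [E]; larger labels go to the default 0, and
   injectivity is asked on [E] only. *)
exists 'I_M.+1, S, (fun a x => inord (p x n a)); split.
- rewrite -ltr_pdivlMr ?card_ord ?ltr0n//.
  have := @densityC R _ (mem S) (ltac:(by rewrite card_ord)).
  rewrite {1}/density card_ord (_ : #|mem S| = #|S|)%N => [SC|]; last exact: eq_card.
  rewrite (_ : density _ = density [predC mem S]) in dS.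
    apply: (@lt_le_trans _ _ (1 - density [predC mem S])); first lra.
    by rewrite -[X in X - _]SC addrK.
  by apply: eq_density => a; rewrite /= !inE.
- move=> a; rewrite inE => /asboolP[asep _] x y /[!inE] Ex Ey.
  move=> /(congr1 (@nat_of_ord _)); rewrite !inordK ?ltnS ?(pM (a, _))//.
  by apply: contraPP => xy; exact: (asep (x, y)).
- move=> a g x; rewrite inE => /asboolP[_ aequiv] Fg Ex _ Egx; congr inord.
  exact: (aequiv (g, x)).
Qed.

Theorem proposition2p9 (R : realType) (G : groupType) (X : Type)
    (alpha : G -> X -> X)
    (G_countable : countable [set: G]) (X_countable : countable [set: X])
    (alpha_action : group_action alpha) :
  sofic_action R alpha <->
  exists (U : free_ultrafilter nat)
         (phi : {multiplicative G -> universal_sofic_group R U})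
         (pi : X -> universal_sofic_space R U),
    (forall (x : X) (g : G),
       universal_sofic_action (phi g) (pi x) = pi (alpha g x)) /\
    (forall x y : X, x <> y -> udist (pi x) (pi y) = 1).
Proof.
split=> [|[U [phi [pi [pi_act pi_dist]]]]].
  exact: sofic_ultraproduct.
exact: ultraproduct_sofic pi_act pi_dist.
Qed.
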